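(* There exists an absolute constant $C>0$ (independent of $m$, $n$, $A$, $Z$ and ${\bf u}$) such that the following holds. Let $m\ge n\ge 1$, let $A\in\mathbb{R}^{m\times m}$ be symmetric positive definite, let $Z\in\mathbb{R}^{m\times n}$ have full column rank, and let $\widehat Q\in\mathbb{R}^{m\times n}$ and $\widehat R\in\mathbb{R}^{n\times n}$ be the factors computed by the algorithm MGS-HA(col), applied to $Z$ and $A$ in floating-point arithmetic with unit rounding error ${\bf u}$ (the algorithm being assumed to run to completion). Then the representation error satisfies $$\|Z-\widehat Q\widehat R\|\le C\,n^{3/2}\,{\bf u}\,\bigl(\|Z\|+\|\widehat Q\|\,\|\widehat R\|\bigr).$$
   Context: Norms without subscript are 2-norms (spectral norm for matrices). Algorithm MGS-HA(col) (high accuracy implementation of column-oriented modified Gram-Schmidt). Input: $Z=[\boldsymbol z_1^{(0)},\dots,\boldsymbol z_n^{(0)}]$ and $A$. For $j=1,\dots,n$ do: (1) for $i=1,\dots,j-1$: $r_{ij} = \boldsymbol p_i^{\rm T}\boldsymbol z_j^{(i-1)}$, then $\boldsymbol z_j^{(i)} = \boldsymbol z_j^{(i-1)} - r_{ij}\boldsymbol q_i$; (2) $\boldsymbol x_j^{(j-1)} = A\boldsymbol z_j^{(j-1)}$; (3) $r_{jj} = \sqrt{(\boldsymbol z_j^{(j-1)})^{\rm T}\boldsymbol x_j^{(j-1)}}$; (4) $\boldsymbol q_j = \boldsymbol z_j^{(j-1)}/r_{jj}$; (5) $\boldsymbol p_j = \boldsymbol x_j^{(j-1)}/r_{jj}$.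 Output: $Q=[\boldsymbol q_1,\dots,\boldsymbol q_n]$ and the upper triangular $R=(r_{ij})\in\mathbb{R}^{n\times n}$ ($r_{ij}=0$ for $i>j$). Hats denote the quantities actually computed in floating-point arithmetic. Floating-point model: the standard model, in which each elementary operation $+,-,\times,/,\sqrt{\ }$ is performed with relative error at most ${\bf u}$, without overflow or underflow, and with $m{\bf u}<1$. The entries of $A$ and $Z$ are taken as exact floating-point data. *)

(* Defs.v *)
From mathcomp Require Import all_boot all_order all_algebra.
From mathcomp Require Import all_classical all_reals all_analysis.

Set Implicit Arguments.
Unset Strict Implicit.
Unset Printing Implicit Defensive.

Import Order.TTheory GRing.Theory Num.Theory.
Local Open Scope classical_set_scope.
Local Open Scope ring_scope.

(* The norm `|_| that MathComp-Analysis puts on matrices is the max norm, so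
   the Euclidean norm and the induced matrix 2-norm are defined here. *)
Definition norm2 (R : realType) (m : nat) (x : 'cV[R]_m) : R :=
  Num.sqrt (\sum_(k < m) x k 0 ^+ 2).

Definition spectral_norm (R : realType) (m n : nat) (M : 'M[R]_(m, n)) : R :=
  sup [set norm2 (M *m x) | x in [set x : 'cV[R]_n | norm2 x = 1]].

Definition symmetric_mx (R : realType) (m : nat) (A : 'M[R]_m) : Prop :=
  A^T = A.

Definition positive_definite (R : realType) (m : nat) (A : 'M[R]_m) : Prop :=
  forall x : 'cV[R]_m, x != 0 -> 0 < (x^T *m A *m x) 0 0.

(* Standard model of floating-point arithmetic, as relations: [c] is an
   admissible computed value of an operation whose exact value is [e].  Each
   occurrence of an operation has its own relative error, and no rounding
   function is fixed. *)
Definition rounded (R : realType) (u e c : R) : Prop :=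
  exists2 delta : R, `|delta| <= u & c = e * (1 + delta).

Definition fl_add (R : realType) (u a b c : R) : Prop := rounded u (a + b) c.
Definition fl_sub (R : realType) (u a b c : R) : Prop := rounded u (a - b) c.
Definition fl_mul (R : realType) (u a b c : R) : Prop := rounded u (a * b) c.

(* Division and square root are total in the library (x / 0 = 0, and
   Num.sqrt x = 0 for x < 0).  The domain conditions make an execution fail
   at a zero divisor or a negative radicand. *)
Definition fl_div (R : realType) (u a b c : R) : Prop :=
  b != 0 /\ rounded u (a / b) c.
Definition fl_sqrt (R : realType) (u a c : R) : Prop :=
  0 <= a /\ rounded u (Num.sqrt a) c.

(* [fl_sum u s c]: [c] is a computed value of the sum of the nonempty list [s],
   the [size s - 1] additions being performed in an arbitrary order. *)
Inductive fl_sum (R : realType) (u : R) : seq R -> R -> Prop :=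
| fl_sum1 (a : R) : fl_sum u [:: a] a
| fl_sumD (s s1 s2 : seq R) (a b c : R) :
    perm_eq s (s1 ++ s2) -> fl_sum u s1 a -> fl_sum u s2 b ->
    fl_add u a b c -> fl_sum u s c.

Definition fl_dot (R : realType) (u : R) (m : nat) (x y : 'cV[R]_m) (c : R) :
    Prop :=
  exists2 w : 'I_m -> R,
    forall k, fl_mul u (x k 0) (y k 0) (w k) &
    fl_sum u [seq w k | k <- enum 'I_m] c.

Definition fl_mulmxv (R : realType) (u : R) (m p : nat) (A : 'M[R]_(m, p))
    (x : 'cV[R]_p) (y : 'cV[R]_m) : Prop :=
  forall k, fl_dot u (row k A)^T x (y k 0).

Definition fl_divv (R : realType) (u : R) (m : nat) (x : 'cV[R]_m) (r : R)
    (y : 'cV[R]_m) : Prop :=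
  forall k, fl_div u (x k 0) r (y k 0).

(* [y] is a computed value of [x - r q]: a multiplication and a subtraction in
   each component. *)
Definition fl_axpy (R : realType) (u : R) (m : nat) (x : 'cV[R]_m) (r : R)
    (q y : 'cV[R]_m) : Prop :=
  forall k, exists2 t : R, fl_mul u r (q k 0) t & fl_sub u (x k 0) t (y k 0).

(* [Q] and [R'] are factors produced by a complete floating-point execution of
   MGS-HA(col) on [Z] and [A].  Columns are numbered from 0, so that [z j i] is
   the j-th column after i projection steps and [z j j] is the vector that gets
   normalized.  The columns of [X] and [P] are the computed x_j and p_j. *)
Definition MGS_HA_col (R : realType) (u : R) (m n : nat) (A : 'M[R]_m)
    (Z Q : 'M[R]_(m, n)) (R' : 'M[R]_n) : Prop :=
  exists (z : 'I_n -> nat -> 'cV[R]_m) (X P : 'M[R]_(m, n)),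
    (forall i j : 'I_n, (j < i)%N -> R' i j = 0) /\
    forall j : 'I_n,
      z j 0%N = col j Z /\
      (forall i : 'I_n, (i < j)%N ->
         fl_dot u (col i P) (z j i) (R' i j) /\
         fl_axpy u (z j i) (R' i j) (col i Q) (z j i.+1)) /\
      fl_mulmxv u A (z j j) (col j X) /\
      (exists2 s : R, fl_dot u (z j j) (col j X) s & fl_sqrt u s (R' j j)) /\
      fl_divv u (z j j) (R' j j) (col j Q) /\
      fl_divv u (col j X) (R' j j) (col j P).

(* Main.v *)
(* Each projection step perturbs the exact relation z' = z - r q by at most
   u |z| + 3 u |r q| in norm, and Q times a truncation of the j-th column of R
   has norm at most |Q| |R|.  With B = |Z| + |Q| |R|, the accumulated error e_i
   of z_j^(i) as an approximation of z_j - sum_(k < i) r_kj q_k therefore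
   satisfies e_(i+1) <= (1 + u) e_i + 4 B u, and |z_j^(i)| <= e_i + B.  Since
   n u < 1, the recurrence gives e_i = O(n u B), so every column of Z - QR has
   norm O(n u B); passing from columns to the spectral norm costs a factor
   sqrt n.  How the r_ij are computed plays no role. *)
Require Import Defs.
From mathcomp Require Import all_boot all_order all_algebra.
From mathcomp Require Import all_classical all_reals all_analysis.
From mathcomp Require Import ring lra.

Set Implicit Arguments.
Unset Strict Implicit.
Unset Printing Implicit Defensive.

Import Order.TTheory GRing.Theory Num.Theory.
Local Open Scope ring_scope.

(** * Euclidean norm: Cauchy-Schwarz, triangle inequality, entrywise comparison *)

Section EuclideanNorm.
Variables (R : realType) (m : nat).
Implicit Types (x y v w : 'cV[R]_m) (a b c : R).

Lemma sumsq_ge0 x : 0 <= \sum_(k < m) x k 0 ^+ 2.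
Proof. by apply: sumr_ge0 => k _; exact: sqr_ge0. Qed.

Lemma norm2_ge0 x : 0 <= norm2 x.
Proof. exact: sqrtr_ge0. Qed.

Lemma norm2_sqr x : norm2 x ^+ 2 = \sum_(k < m) x k 0 ^+ 2.
Proof. by rewrite sqr_sqrtr // sumsq_ge0. Qed.

Lemma norm2_eq0 x : norm2 x = 0 -> x = 0.
Proof.
move=> x0; have := norm2_sqr x; rewrite x0 expr0n /= => /esym/eqP.
rewrite psumr_eq0; last by move=> k _; exact: sqr_ge0.
move=> /allP x_0; apply/matrixP => k l; rewrite ord1 mxE.
by apply/eqP; rewrite -sqrf_eq0; apply: x_0; rewrite mem_index_enum.
Qed.

Lemma norm2_0 : norm2 (0 : 'cV[R]_m) = 0.
Proof. by rewrite /norm2 big1 ?sqrtr0 // => k _; rewrite mxE expr0n. Qed.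

Lemma norm2Z a x : norm2 (a *: x) = `|a| * norm2 x.
Proof.
rewrite /norm2 -sqrtr_sqr -sqrtrM ?sqr_ge0 //; congr (Num.sqrt _).
by rewrite mulr_sumr; apply: eq_bigr => k _; rewrite mxE exprMn.
Qed.

Lemma norm2N x : norm2 (- x) = norm2 x.
Proof. by rewrite -scaleN1r norm2Z normrN normr1 mul1r. Qed.

Lemma ler_norm2 x y : (forall k, `|x k 0| <= `|y k 0|) -> norm2 x <= norm2 y.
Proof.
move=> xy; rewrite ler_wsqrtr //; apply: ler_sum => k _.
by rewrite -(real_normK (num_real (x k 0))) -(real_normK (num_real (y k 0)))
  ler_pXn2r ?nnegrE.
Qed.

Lemma norm2_map_norm x : norm2 (map_mx Num.norm x) = norm2 x.
Proof.
by congr (Num.sqrt _); apply: eq_bigr => k _; rewrite mxE real_normK // num_real.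
Qed.

(** Sum the inequalities [0 <= (|y| x_k - |x| y_k)^2] over [k], then divide by [2 |x| |y|]; vectors
    of norm zero are treated first to allow the division. *)
Lemma cauchy_schwarz_norm2 x y :
  \sum_(k < m) x k 0 * y k 0 <= norm2 x * norm2 y.
Proof.
have [/norm2_eq0 ->|x0] := eqVneq (norm2 x) 0.
  by rewrite norm2_0 mul0r big1 // => k _; rewrite mxE mul0r.
have [/norm2_eq0 ->|y0] := eqVneq (norm2 y) 0.
  by rewrite norm2_0 mulr0 big1 // => k _; rewrite mxE mulr0.
have xgt0 : 0 < norm2 x by rewrite lt0r x0 norm2_ge0.
have ygt0 : 0 < norm2 y by rewrite lt0r y0 norm2_ge0.
have xygt0 := mulr_gt0 xgt0 ygt0.
rewrite -(ler_pM2l (mulr_gt0 (ltr0Sn R 1) xygt0)) mulr_sumr.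
apply: (@le_trans _ _ (\sum_(k < m)
    (norm2 y ^+ 2 * x k 0 ^+ 2 + norm2 x ^+ 2 * y k 0 ^+ 2))).
  apply: ler_sum => k _.
  by have := sqr_ge0 (norm2 y * x k 0 - norm2 x * y k 0); lra.
rewrite big_split /= -!mulr_sumr -!norm2_sqr; lra.
Qed.

Lemma ler_norm2D x y : norm2 (x + y) <= norm2 x + norm2 y.
Proof.
have xy0 : 0 <= norm2 x + norm2 y by rewrite addr_ge0 // norm2_ge0.
rewrite -(ler_pXn2r (n := 2)) ?nnegrE ?norm2_ge0 // norm2_sqr.
have -> : \sum_(k < m) (x + y) k 0 ^+ 2 =
    norm2 x ^+ 2 + norm2 y ^+ 2 + 2 * \sum_(k < m) x k 0 * y k 0.
  rewrite !norm2_sqr mulr_sumr -!big_split /=.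
  by apply: eq_bigr => k _; rewrite mxE; ring.
by have := cauchy_schwarz_norm2 x y; lra.
Qed.

(** Turns entrywise rounding bounds into norm bounds. Taking absolute values of the entries
    preserves the norm, so no factor depending on the dimension [m] appears. *)
Lemma ler_norm2_comb a b v x y : 0 <= a -> 0 <= b ->
  (forall k, `|v k 0| <= a * `|x k 0| + b * `|y k 0|) ->
  norm2 v <= a * norm2 x + b * norm2 y.
Proof.
move=> a0 b0 vxy.
rewrite -(norm2_map_norm x) -(norm2_map_norm y).
rewrite -{1}(ger0_norm a0) -{1}(ger0_norm b0) -!norm2Z.
apply: le_trans (ler_norm2D _ _).
by apply: ler_norm2 => k; rewrite !mxE (le_trans (vxy k)) // ler_norm.
Qed.

Lemma ler_norm2_sum (I : Type) (r : seq I) (P : pred I) (F : I -> 'cV[R]_m) :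
  norm2 (\sum_(i <- r | P i) F i) <= \sum_(i <- r | P i) norm2 (F i).
Proof.
elim/big_rec2: _ => [|i a v _ va]; first by rewrite norm2_0.
by rewrite (le_trans (ler_norm2D _ _)) // lerD2l.
Qed.

(** Cauchy-Schwarz against the all-ones vector. *)
Lemma ler_sum_norm2 x : \sum_(k < m) `|x k 0| <= Num.sqrt m%:R * norm2 x.
Proof.
have := cauchy_schwarz_norm2 (const_mx 1) (map_mx Num.norm x).
have -> : norm2 (const_mx 1 : 'cV[R]_m) = Num.sqrt m%:R.
  congr (Num.sqrt _); rewrite (eq_bigr (fun=> 1)).
    by rewrite sumr_const card_ord.
  by move=> k _; rewrite mxE expr1n.
rewrite norm2_map_norm; congr (_ <= _).
by apply: eq_bigr => k _; rewrite !mxE mul1r.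
Qed.

Lemma ler_norm2_entry x k : `|x k 0| <= norm2 x.
Proof.
rewrite -sqrtr_sqr ler_wsqrtr // (bigD1 k) //= lerDl.
by apply: sumr_ge0 => l _; exact: sqr_ge0.
Qed.

Lemma norm2_delta k : norm2 (delta_mx k 0 : 'cV[R]_m) = 1.
Proof.
rewrite /norm2 (bigD1 k) //= mxE !eqxx expr1n big1 ?addr0 ?sqrtr1 // => l lk.
by rewrite mxE (negPf lk) expr0n.
Qed.

End EuclideanNorm.

(** * Spectral norm: comparison with the norms of the columns *)

Section SpectralNorm.
Variables (R : realType) (m n : nat).
Implicit Types (M : 'M[R]_(m, n)) (x : 'cV[R]_n).

(** [M x] is a combination of the columns of [M] with coefficients [x_j], and the sum of the [|x_j|]
    is at most [sqrt n |x|]. *)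
Lemma norm2_mulmx_cols M x c : (forall j, norm2 (col j M) <= c) ->
  norm2 (M *m x) <= Num.sqrt n%:R * c * norm2 x.
Proof.
(* For [n = 0] the hypothesis is vacuous and [c] could be negative; otherwise any column shows
   [0 <= c]. *)
move=> Mc; case: (posnP n) => [n0|n_gt0].
  have -> : x = 0.
    by apply/matrixP => -[k kn]; exfalso; move: kn; rewrite n0.
  by rewrite mulmx0 !norm2_0 mulr0.
have c0 : 0 <= c := le_trans (norm2_ge0 _) (Mc (Ordinal n_gt0)).
have -> : M *m x = \sum_j x j 0 *: col j M.
  apply/matrixP => i l; rewrite ord1 mxE summxE.
  by apply: eq_bigr => k _; rewrite !mxE mulrC.
apply: le_trans (ler_norm2_sum _ _ _) _.
apply: (@le_trans _ _ (\sum_j c * `|x j 0|)).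
  by apply: ler_sum => j _; rewrite norm2Z mulrC ler_wpM2r.
by rewrite -mulr_sumr [leLHS]mulrC [leRHS]mulrAC ler_wpM2r // ler_sum_norm2.
Qed.

(** Guarantees that the [sup] defining the spectral norm is a genuine upper bound; the sum of all
    column norms serves as a common column bound. *)
Lemma spectral_norm_has_ubound M :
  has_ubound [set norm2 (M *m x) | x in [set x : 'cV[R]_n | norm2 x = 1]]%classic.
Proof.
exists (Num.sqrt n%:R * \sum_j norm2 (col j M)) => _ [x /= x1 <-].
have := @norm2_mulmx_cols M x (\sum_j norm2 (col j M)).
rewrite x1 mulr1; apply => j; rewrite (bigD1 j) //= lerDl.
by apply: sumr_ge0 => k _; exact: norm2_ge0.
Qed.

Lemma ler_norm2_mulmx M x : norm2 (M *m x) <= spectral_norm M * norm2 x.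
Proof.
have [x0|x0] := eqVneq (norm2 x) 0.
  by rewrite x0 (norm2_eq0 x0) mulmx0 norm2_0 mulr0.
have xgt0 : 0 < norm2 x by rewrite lt0r x0 norm2_ge0.
rewrite -ler_pdivrMr //.
apply: (ub_le_sup (spectral_norm_has_ubound M)).
exists ((norm2 x)^-1 *: x) => /=.
  by rewrite norm2Z ger0_norm ?invr_ge0 ?norm2_ge0 // mulVf.
by rewrite -scalemxAr norm2Z ger0_norm ?invr_ge0 ?norm2_ge0 // mulrC.
Qed.

Lemma ler_norm2_col M j : norm2 (col j M) <= spectral_norm M.
Proof.
by have := ler_norm2_mulmx M (delta_mx j 0); rewrite norm2_delta mulr1 colE.
Qed.

Lemma spectral_norm_le_cols M c : (0 < n)%N -> (forall j, norm2 (col j M) <= c) ->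
  spectral_norm M <= Num.sqrt n%:R * c.
Proof.
move=> n_gt0 Mc; apply: ge_sup.
  (* A basis vector shows that the set under the [sup] is nonempty. *)
  exists (norm2 (M *m delta_mx (Ordinal n_gt0) 0)).
  by exists (delta_mx (Ordinal n_gt0) 0) => //=; exact: norm2_delta.
by move=> _ [x /= x1 <-]; have := norm2_mulmx_cols x Mc; rewrite x1 mulr1.
Qed.

Lemma spectral_norm_ge0 M : (0 < n)%N -> 0 <= spectral_norm M.
Proof.
by move=> n_gt0; exact: le_trans (norm2_ge0 _) (ler_norm2_col M (Ordinal n_gt0)).
Qed.

End SpectralNorm.

(** * Rounding errors of one projection step and of the normalization *)

Section RoundedOperations.
Variables (R : realType) (m : nat) (u : R).
Hypotheses (u_ge0 : 0 <= u) (u_le1 : u <= 1).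
Implicit Types (x q y : 'cV[R]_m) (r : R).

Lemma fl_axpy_error x r q y : fl_axpy u x r q y ->
  norm2 (y - x + r *: q) <= u * norm2 x + 3 * u * (`|r| * norm2 q).
Proof.
move=> xy; rewrite -norm2Z; apply: ler_norm2_comb; [done|exact: mulr_ge0|] => k.
rewrite !mxE; case: (xy k) => t [d du ->] [e eu ->].
set a := x k 0; set b := r * q k 0.
(* The coefficient of [b] is at most [3 u] in absolute value, because [|e| <= 1] gives
   [|e d| <= u]. *)
have -> : (a - b * (1 + d)) * (1 + e) - a + b = e * a - (e + d + e * d) * b.
  by ring.
apply: le_trans (ler_normB _ _) _; rewrite !normrM.
apply: lerD; first by rewrite ler_wpM2r.
rewrite ler_wpM2r //.
apply: le_trans (ler_normD _ _) _; apply: (@le_trans _ _ (u + u + u)); last by lra.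
apply: lerD; first by apply: le_trans (ler_normD _ _) _; exact: lerD.
by rewrite normrM -[leRHS]mul1r ler_pM // (le_trans eu).
Qed.

Lemma fl_divv_error x r y : fl_divv u x r y ->
  norm2 (x - r *: y) <= u * norm2 x.
Proof.
move=> xy; have := @ler_norm2_comb R m u 0 (x - r *: y) x 0 u_ge0 (lexx 0).
rewrite mul0r addr0; apply => k; rewrite mul0r addr0 !mxE.
case: (xy k) => r0 [d du ->].
(* Multiplying back by the nonzero [r] cancels the quotient, so the residual is relative to [x]
   alone. *)
have -> : x k 0 - r * (x k 0 / r * (1 + d)) = - (d * x k 0) by field.
by rewrite normrN normrM ler_wpM2r.
Qed.

End RoundedOperations.

(* The quadratic term absorbs the geometric growth factor 1 + u as long as
   i u <= 1. *)
Lemma affine_recurrence_le (R : realType) (u c : R) (n : nat) (e : nat -> R) :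
  0 <= u -> 0 <= c -> n%:R * u <= 1 -> e 0%N <= 0 ->
  (forall i, (i < n)%N -> e i.+1 <= (1 + u) * e i + c * u) ->
  forall i, (i <= n)%N -> e i <= c * (i%:R * u + (i%:R * u) ^+ 2).
Proof.
move=> u0 c0 nu e0 eS; elim=> [|i IH] i_n; first by rewrite mul0r expr0n addr0 mulr0.
apply: le_trans (eS i i_n) _.
have u1 : 0 <= 1 + u by lra.
apply: le_trans (lerD (ler_wpM2l u1 (IH (ltnW i_n))) (lexx _)) _.
set t : R := i%:R.
have t0 : 0 <= t by rewrite ler0n.
have tu : t * u <= 1.
  by apply: le_trans nu; rewrite ler_wpM2r // ler_nat ltnW.
have -> : (1 + u) * (c * (t * u + (t * u) ^+ 2)) + c * u =
    c * ((1 + u) * (t * u + (t * u) ^+ 2) + u) by ring.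
rewrite ler_wpM2l // -natr1 -/t.
(* The cubic term is at most [t u^2]; with the other [t u^2] it fits into the [2 t u^2] of the
   expanded square. *)
have : u * (t * u) * (t * u) <= u * t * u * 1.
  by rewrite -[u * t * u]mulrA ler_wpM2l // !mulr_ge0.
have : 0 <= u ^+ 2 by exact: sqr_ge0.
have -> : (t + 1) * u + ((t + 1) * u) ^+ 2 =
  t * u + u + (t * u) ^+ 2 + 2 * (t * u * u) + u ^+ 2 by ring.
lra.
Qed.


(** * Partial sums of the columns of the product of the factors *)

Section FactorColumns.
Variables (R : realType) (m n : nat) (Q : 'M[R]_(m, n)) (T : 'M[R]_n).

(** The total that [i] unrounded projection steps would subtract from column [j]. The index [i] is a
    natural number so that it can reach [j.+1], where the diagonal term is included. *)
Definition partial_mulmx_col (j : 'I_n) (i : nat) : 'cV[R]_m :=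
  \sum_(k < n | (k < i)%N) T k j *: col k Q.

Lemma partial_mulmx_col0 j : partial_mulmx_col j 0 = 0.
Proof. by rewrite /partial_mulmx_col big_pred0. Qed.

Lemma partial_mulmx_colS j (i : 'I_n) :
  partial_mulmx_col j i.+1 = partial_mulmx_col j i + T i j *: col i Q.
Proof.
rewrite /partial_mulmx_col (bigD1 i) //= addrC; congr (_ + _).
by apply: eq_bigl => k; rewrite ltnS ltn_neqAle andbC.
Qed.

Lemma partial_mulmx_col_upper (j : 'I_n) :
  (forall i : 'I_n, (j < i)%N -> T i j = 0) ->
  partial_mulmx_col j j.+1 = col j (Q *m T).
Proof.
move=> T0; apply/matrixP => k l; rewrite ord1 /partial_mulmx_col summxE !mxE.
rewrite [RHS](bigID (fun i : 'I_n => (i < j.+1)%N)) /= [X in _ + X]big1; last first.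
  by move=> i; rewrite -leqNgt => ji; rewrite T0 // mulr0.
by rewrite addr0; apply: eq_bigr => i _; rewrite !mxE mulrC.
Qed.

(** The partial sum is [Q] times a truncated column of [T], and truncation does not increase the
    norm; hence the bound has no factor growing with [i]. *)
Lemma norm2_partial_mulmx_col j i :
  norm2 (partial_mulmx_col j i) <= spectral_norm Q * spectral_norm T.
Proof.
pose v : 'cV[R]_n := \col_k (if (k < i)%N then T k j else 0).
have -> : partial_mulmx_col j i = Q *m v.
  apply/matrixP => k l; rewrite ord1 /partial_mulmx_col summxE mxE big_mkcond.
  by apply: eq_bigr => p _; rewrite !mxE; case: ifP; rewrite ?mulr0 // mulrC.
have n_gt0 : (0 < n)%N by apply: leq_ltn_trans (ltn_ord j).
apply: le_trans (ler_norm2_mulmx _ _) _.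
rewrite ler_wpM2l ?spectral_norm_ge0 //; apply: le_trans (ler_norm2_col T j).
by apply: ler_norm2 => k; rewrite !mxE; case: ifP; rewrite ?normr0.
Qed.

Lemma norm2_mulmx_term j i :
  `|T i j| * norm2 (col i Q) <= spectral_norm Q * spectral_norm T.
Proof.
rewrite mulrC ler_pM ?norm2_ge0 ?ler_norm2_col //.
apply: le_trans (ler_norm2_col T j).
by have := ler_norm2_entry (col j T) i; rewrite mxE.
Qed.

End FactorColumns.

(** * Error of one column, and the final bound *)

Lemma MGS_HA_col_column_error (R : realType) (m n : nat) (u : R) (A : 'M[R]_m)
    (Z Q : 'M[R]_(m, n)) (T : 'M[R]_n) (j : 'I_n) :
  0 <= u -> u <= 1 -> n%:R * u <= 1 -> MGS_HA_col u A Z Q T ->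
  norm2 (col j (Z - Q *m T)) <=
    17 * n%:R * u * (spectral_norm Z + spectral_norm Q * spectral_norm T).
Proof.
move=> u0 u1 nu [z [X [P [Tupper exec]]]].
have [zj0 [zjS [_ [_ [Qj _]]]]] := exec j.
set B := spectral_norm Z + _; pose S := partial_mulmx_col Q T j.
have n_gt0 : (0 < n)%N by apply: leq_ltn_trans (ltn_ord j).
have QT0 : 0 <= spectral_norm Q * spectral_norm T.
  by rewrite mulr_ge0 // spectral_norm_ge0.
have QTB : spectral_norm Q * spectral_norm T <= B.
  by rewrite lerDr spectral_norm_ge0.
have B0 : 0 <= B := le_trans QT0 QTB.
pose d i := z j i - col j Z + S i.
have zB i : norm2 (z j i) <= norm2 (d i) + B.
  have -> : z j i = d i + (col j Z + - S i) by rewrite /d addrACA subrK subrr addr0.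
  apply: le_trans (ler_norm2D _ _) _; rewrite lerD2l.
  apply: le_trans (ler_norm2D _ _) _; rewrite norm2N.
  by apply: lerD; [exact: ler_norm2_col|exact: norm2_partial_mulmx_col].
(* The new error [u |z| + 3 u |r q|] is at most [u (|d i| + B) + 3 u B]. *)
have dS i : (i < j)%N -> norm2 (d i.+1) <= (1 + u) * norm2 (d i) + 4 * B * u.
  move=> ij; pose k := Ordinal (ltn_trans ij (ltn_ord j)).
  have [_ /(fl_axpy_error u0 u1)] := zjS k ij.
  rewrite [nat_of_ord k]/= => err.
  have -> : d i.+1 = d i + (z j i.+1 - z j i + T k j *: col k Q).
    rewrite /d /S (partial_mulmx_colS Q T j k) /=.
    by apply/matrixP => p q; rewrite !mxE; ring.
  apply: le_trans (ler_norm2D _ _) _.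
  have := ler_wpM2l u0 (zB i).
  have := ler_wpM2l u0 (le_trans (norm2_mulmx_term Q T j k) QTB).
  lra.
have d0 : norm2 (d 0%N) <= 0.
  by rewrite /d /S partial_mulmx_col0 zj0 subrr addr0 norm2_0.
have jn : (j%:R : R) <= n%:R by rewrite ler_nat ltnW.
have ju : j%:R * u <= 1 by apply: le_trans nu; rewrite ler_wpM2r.
have := affine_recurrence_le u0 (mulr_ge0 (ler0n R 4) B0) ju d0 dS (leqnn j).
(* Splits off the normalization residual from the error accumulated by the projections. *)
have -> : col j (Z - Q *m T) = (z j j - T j j *: col j Q) - d j.
  rewrite linearB /= -partial_mulmx_col_upper; last by move=> i; exact: Tupper.
  rewrite partial_mulmx_colS /d /S.
  by apply/matrixP => p q; rewrite !mxE; ring.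
move=> dj; apply: le_trans (ler_norm2D _ _) _; rewrite norm2N.
have := fl_divv_error u0 Qj; have := ler_wpM2l u0 (zB j).
have ju0 : 0 <= j%:R * u by rewrite mulr_ge0.
have jusq : (j%:R * u) ^+ 2 <= j%:R * u.
  by rewrite expr2 -[leRHS]mulr1 ler_wpM2l.
(* The constant 17 is 8 from [d j] plus 9 from the normalization, whose error is at most
   [u |z j j| <= u (8 B + B)]. *)
have dj8 : norm2 (d j) <= 8 * B * (j%:R * u).
  apply: le_trans dj _; have := ler_wpM2l B0 jusq; lra.
have dj8' : norm2 (d j) <= 8 * B.
  by apply: le_trans dj8 _; rewrite -[leRHS]mulr1 ler_wpM2l // mulr_ge0.
have Bun : B * (j%:R * u) <= B * (n%:R * u) by rewrite ler_wpM2l // ler_wpM2r.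
have Bu : B * u <= B * (n%:R * u).
  by rewrite ler_wpM2l // -[leLHS]mul1r ler_wpM2r // ler1n.
have := ler_wpM2l u0 dj8'.
lra.
Qed.

Theorem mainTheorem2 (R : realType) :
  exists C : R, 0 < C /\
    forall (m n : nat) (u : R) (A : 'M[R]_m) (Z Qh : 'M[R]_(m, n))
           (Rh : 'M[R]_n),
      (1 <= n)%N -> (n <= m)%N ->
      0 < u -> m%:R * u < 1 ->
      symmetric_mx A -> positive_definite A ->
      \rank Z = n ->
      MGS_HA_col u A Z Qh Rh ->
      spectral_norm (Z - Qh *m Rh) <=
        C * n%:R `^ (3 / 2) * u *
          (spectral_norm Z + spectral_norm Qh * spectral_norm Rh).
Proof.
exists 17; split=> // m n u A Z Q T n_gt0 nm u_gt0 mu _ _ _ exec.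
have u0 := ltW u_gt0.
have nu : n%:R * u <= 1.
  by apply: le_trans (ltW mu); rewrite ler_wpM2r // ler_nat.
have u1 : u <= 1.
  by apply: le_trans nu; rewrite -[leLHS]mul1r ler_wpM2r // ler1n.
apply: le_trans (spectral_norm_le_cols n_gt0 (fun j =>
  MGS_HA_col_column_error j u0 u1 nu exec)) _.
(* The factor [n] counts projection steps; [sqrt n] comes from passing from columns to the spectral
   norm. *)
have -> : n%:R `^ (3 / 2) = n%:R * Num.sqrt n%:R :> R.
  have -> : 3 / 2 = 1 + 2^-1 :> R by field.
  rewrite powRD ?powRr1 ?powR12_sqrt //.
  by apply/implyP => _; rewrite pnatr_eq0 -lt0n.
rewrite le_eqVlt; apply/orP; left; apply/eqP; ring.
Qed.
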